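(* Let $\theta\in\,]0,1[$ be fixed and, for $n\in\mathbb{N}$, let $m=\lfloor\theta n\rfloor$ (with $m\ge1$). There exist constants $\mathcal{C}_1,\mathcal{C}_2>0$ independent of $n,m,x$ such that $$\mathcal{C}_1\lambda_n^m(x)\le\tilde\lambda_n^m(x)\le\mathcal{C}_2\lambda_n^m(x),\qquad |x|\le1,$$ where $\lambda_n^m(x)=\int_{-1}^1|s_n^m(x,y)|w(y)\,dy$ and $\tilde\lambda_n^m(x)=\frac{\pi}{n}\sum_{i=1}^n|s_n^m(x_i^n,x)|$.
   Context: Let $w(x)=(1-x^2)^{-1/2}$ on $[-1,1]$. The orthonormal Chebyshev polynomials are $p_0=\sqrt{1/\pi}$, $p_r(x)=\sqrt{2/\pi}\cos(r\arccos x)$, $r\ge1$; Chebyshev nodes $x_k^n=\cos\frac{(2k-1)\pi}{2n}$, $k=1,\ldots,n$. For $0<m<n$: $\mu_{n,r}^m=1$ if $0\le r\le n-m$, $\frac{m+n-r}{2m}$ if $n-m<r<n+m$, $0$ otherwise; for $r=0,\ldots,n-1$, $q_{n,r}^m=p_r$ if $r\le n-m$ and $q_{n,r}^m=\mu_{n,r}^mp_r-\mu_{n,2n-r}^mp_{2n-r}$ if $n-m<r<n$; $\nu_{n,r}^m=1$ if $r\le n-m$, $\frac{m^2+(n-r)^2}{2m^2}$ if $n-m<r<n$. Orthonormal VP scaling functions: $\tilde\varphi_{n,k}^m=\sum_{r=0}^{n-1}\sqrt{\frac{\pi}{n\nu_{n,r}^m}}p_r(x_k^n)q_{n,r}^m$,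 and $s_n^m(x,y)=\sum_{k=1}^n\tilde\varphi_{n,k}^m(x)\tilde\varphi_{n,k}^m(y)$ (equivalently $\sum_{r=0}^{n-1}q_{n,r}^m(x)q_{n,r}^m(y)/\nu_{n,r}^m$). *)

(* Defs.v *)
From HB Require Import structures.
From mathcomp Require Import all_boot all_order all_algebra.
From mathcomp Require Import all_classical all_reals all_analysis.
Set Implicit Arguments. Unset Strict Implicit. Unset Printing Implicit Defensive.
Import Order.TTheory GRing.Theory Num.Theory.
Import numFieldNormedType.Exports.
Local Open Scope classical_set_scope.
Local Open Scope ring_scope.

Section Cheb.
Variable R : realType.

(* Chebyshev weight w(x) = (1-x^2)^(-1/2) (value at x = +-1 irrelevant: null set) *)
Definition cheb_w (x : R) : R := (Num.sqrt (1 - x ^+ 2))^-1.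

Definition cheb_p (r : nat) (x : R) : R :=
  if r == 0%N then Num.sqrt (pi^-1)
  else Num.sqrt (2 / pi) * cos (r%:R * acos x).

(* Chebyshev nodes x_k^n, k = 1..n *)
Definition cheb_node (n k : nat) : R := cos ((2 * k - 1)%N%:R * pi / (2 * n)%N%:R).

Definition vp_mu (n m r : nat) : R :=
  if (r <= n - m)%N then 1
  else if (r < n + m)%N then ((m + n)%:R - r%:R) / (2 * m)%N%:R
  else 0.

(* q_{n,r}^m for r = 0..n-1 *)
Definition vp_q (n m r : nat) (x : R) : R :=
  if (r <= n - m)%N then cheb_p r x
  else vp_mu n m r * cheb_p r x - vp_mu n m (2 * n - r) * cheb_p (2 * n - r) x.

Definition vp_nu (n m r : nat) : R :=
  if (r <= n - m)%N then 1
  else ((m ^ 2)%:R + (n%:R - r%:R) ^+ 2) / (2 * m ^ 2)%N%:R.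

Definition vp_phi (n m k : nat) (x : R) : R :=
  \sum_(r < n) Num.sqrt (pi / (n%:R * vp_nu n m r)) * cheb_p r (cheb_node n k) * vp_q n m r x.

Definition vp_s (n m : nat) (x y : R) : R :=
  \sum_(1 <= k < n.+1) vp_phi n m k x * vp_phi n m k y.

Definition vp_lambda (n m : nat) (x : R) : \bar R :=
  (\int[@lebesgue_measure R]_(y in `[(-1)%R, 1%R]) (`|vp_s n m x y| * cheb_w y)%:E)%E.

Definition vp_lambda_tilde (n m : nat) (x : R) : R :=
  pi / n%:R * \sum_(1 <= i < n.+1) `|vp_s n m (cheb_node n i) x|.

End Cheb.

(* Main.v *)
(* For fixed x, F = s_n^m(x, .) lies in the span of the q_{n,r}^m. Let
   G_N(x, y) = [cesaro_kernel N x y] = sum_(r < N) (N - r) p_r(x) p_r(y), which is N times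
   a Cesaro mean and hence nonnegative by Fejer's formula. Its integral against w is N, and
   for N <= 2n so is its Gauss-Chebyshev sum over the n nodes.
   - Since deg F <= n + m, for a = 2n and b = n + m one has
     (a - b) F(z) = int F (G_a - G_b)(z, .) w. Taking absolute values and summing over the
     nodes gives lambda~ <= (a + b) / (a - b) lambda.
   - The VP interpolation formula reads, for a = n + m and b = n - m,
     (a - b) F(y) = pi / n sum_i F(x_i) (G_a - G_b)(x_i, y). Taking absolute values and
     integrating gives lambda <= (a + b) / (a - b) lambda~.
   For m ~ theta n both constants are bounded in terms of theta only. *)
Require Import Defs.
From HB Require Import structures.
From mathcomp Require Import all_boot all_order all_algebra.
From mathcomp Require Import all_classical all_reals all_analysis.
From mathcomp Require Import measurable_realfun ring lra zify.
Import Order.TTheory GRing.Theory Num.Theory.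
Import numFieldNormedType.Exports.
Local Open Scope ring_scope.

(** * Chebyshev polynomials as cosines, and positivity of the Cesaro kernels *)

Section Trigonometry.
Context {R : realType}.
Implicit Types (x y u : R) (N n m r j k : nat).

Definition cheb_c r : R := if r == 0%N then Num.sqrt (pi^-1) else Num.sqrt (2 / pi).

Lemma cheb_pE r x : cheb_p r x = cheb_c r * cos (r%:R * acos x).
Proof. by rewrite /cheb_p /cheb_c; case: eqP => // ->; rewrite mul0r cos0 mulr1. Qed.

Lemma cheb_c_sqr r : cheb_c r ^+ 2 = (2 - (r == 0)%:R) / pi.
Proof.
rewrite /cheb_c; case: eqP => _ /=; rewrite sqr_sqrtr ?subr0 ?divr_ge0 ?invr_ge0 ?pi_ge0//.
by rewrite (_ : 2 - 1 = 1) ?mul1r//; lra.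
Qed.

Lemma cosMcos x y : cos x * cos y = (cos (x - y) + cos (x + y)) / 2.
Proof. by rewrite cosB cosD; field. Qed.

(** With truncated subtraction, [(r - j) + (j - r)] is |r - j|. Both frequencies are then natural
    numbers, the form in which cosines are integrated and summed over the nodes. *)
Lemma cosMcos_nat r j u : cos (r%:R * u) * cos (j%:R * u) =
  (cos (((r - j) + (j - r))%N%:R * u) + cos ((r + j)%N%:R * u)) / 2.
Proof.
rewrite cosMcos -mulrBl -mulrDl -natrD; congr ((_ + _) / _).
case: (leqP j r) => [jr|/ltnW rj].
  by rewrite (eqP jr) addn0 natrB.
by rewrite (eqP rj) add0n natrB// -cosN -mulNr opprB.
Qed.

Lemma cheb_pM r j x : cheb_p r x * cheb_p j x = cheb_c r * cheb_c j / 2 *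
  (cos (((r - j) + (j - r))%N%:R * acos x) + cos ((r + j)%N%:R * acos x)).
Proof. by rewrite !cheb_pE mulrACA cosMcos_nat; field. Qed.

(** The common final computation of continuous and discrete orthogonality: in [cheb_pM], each cosine
    of frequency k has been replaced by its integral, pi for k = 0 and 0 otherwise. *)
Lemma cheb_c_orthonormal r j :
  cheb_c r * cheb_c j / 2 *
  (pi * ((r - j) + (j - r) == 0)%N%:R + pi * (r + j == 0)%N%:R) = (r == j)%:R.
Proof.
have pi0 := lt0r_neq0 (@pi_gt0 R).
rewrite !addn_eq0 !subn_eq0 -eqn_leq; case: eqVneq => [<-|rj]; last first.
  rewrite (_ : _ && _ = false) ?mulr0 ?addr0 ?mulr0//.
  by apply/negbTE; apply: contraNN rj => /andP[/eqP-> /eqP->].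
rewrite andbb -expr2 cheb_c_sqr; move: (@pi R) pi0 => p p0.
by case: (r == 0%N) => /=; field.
Qed.

(** N times the Fejer kernel, the sum of (N - |r|) e^(iru) over |r| < N. *)
Definition fejer N u : R := N%:R + 2 * \sum_(1 <= r < N) (N - r)%:R * cos (r%:R * u).

(** The right-hand side is |sum of e^(iku) over k < N|^2. Passing from N to N + 1 adds 1 + 2 (sum of
    cos(ru) over 1 <= r <= N) to either side. *)
Lemma fejer_sqr N u :
  fejer N u = (\sum_(k < N) cos (k%:R * u)) ^+ 2 + (\sum_(k < N) sin (k%:R * u)) ^+ 2.
Proof.
rewrite /fejer; elim: N => [|N IH].
  by rewrite big_geq// !big_ord0 mulr0 expr0n addr0.
have step : \sum_(1 <= r < N.+1) (N.+1 - r)%:R * cos (r%:R * u) =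
  \sum_(1 <= r < N) (N - r)%:R * cos (r%:R * u) + \sum_(1 <= r < N.+1) cos (r%:R * u).
  case: (posnP N) => [->|N0]; first by rewrite !big_geq// addr0.
  rewrite [X in X = _]big_nat_recr// [X in _ = _ + X]big_nat_recr//= addrA -big_split/=.
  rewrite subSnn mul1r; congr (_ + _).
  rewrite big_nat_cond [RHS]big_nat_cond; apply: eq_bigr => r /andP[/andP[_ rN] _].
  by rewrite subSn 1?ltnW// -natr1 mulrDl mul1r.
(* With r = N - k each term is cos(Nu - ku); twice this sum is the cross term of the enlarged
   squares. *)
have conv : \sum_(1 <= r < N.+1) cos (r%:R * u) =
    cos (N%:R * u) * (\sum_(k < N) cos (k%:R * u)) +
    sin (N%:R * u) * (\sum_(k < N) sin (k%:R * u)).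
  rewrite !mulr_sumr -big_split/= -(big_mkord xpredT (fun k => cos (N%:R * u) * cos (k%:R * u) +
    sin (N%:R * u) * sin (k%:R * u))) big_nat_rev/= big_add1/= big_nat_cond [RHS]big_nat_cond.
  apply: eq_bigr => k /andP[/andP[_ kN] _].
  by rewrite -cosB -mulrBl -natrB ?(ltnW kN)// add1n !subSS.
rewrite !big_ord_recr/= step conv.
have c2 : sin (N%:R * u) ^+ 2 = 1 - cos (N%:R * u) ^+ 2 by rewrite sin2cos2.
rewrite !sqrrD c2 -natr1 2!mulrDr; move: IH.
set A := \sum_(1 <= r < N) _; set C := \sum_(k < N) cos _; set S := \sum_(k < N) sin _.
move: A C S => A C S /(canRL (addKr _)) IH.
by rewrite IH; ring.
Qed.

Lemma fejer_ge0 N u : 0 <= fejer N u.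
Proof. by rewrite fejer_sqr addr_ge0 ?sqr_ge0. Qed.

Definition cesaro_kernel N x y : R := \sum_(r < N) (N - r)%:R * (cheb_p r x * cheb_p r y).

(** Product-to-sum for cosines. The term r = 0 is split off because its squared normalization is 1 /
    pi instead of 2 / pi; it yields the constant term of [fejer]. *)
Lemma cesaro_kernel_fejer N x y : cesaro_kernel N x y =
  (fejer N (acos x - acos y) + fejer N (acos x + acos y)) / (2 * pi).
Proof.
have pi0 := lt0r_neq0 (@pi_gt0 R).
case: N => [|N].
  by rewrite /cesaro_kernel /fejer big_ord0 !big_geq// mulr0 addr0 mulr0n addr0 mul0r.
rewrite /cesaro_kernel /fejer big_ord_recl/= !big_add1/= !big_mkord !mulr_sumr.
rewrite addrACA -big_split/= mulrDl mulr_suml; congr (_ + _).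
  rewrite !cheb_pE !mul0r !cos0 !mulr1 -expr2 cheb_c_sqr/= subn0.
  by move: (@pi R) pi0 => p p0; field.
apply: eq_bigr => r _; rewrite !cheb_pE mulrACA -expr2 cheb_c_sqr/= cosMcos /bump/= add1n.
by rewrite -!mulrDr -!mulrBr; move: (@pi R) pi0 => p p0; field.
Qed.

Lemma cesaro_kernel_ge0 N x y : 0 <= cesaro_kernel N x y.
Proof.
rewrite cesaro_kernel_fejer divr_ge0//; first by rewrite addr_ge0 ?fejer_ge0.
by rewrite mulr_ge0 ?pi_ge0.
Qed.

End Trigonometry.

(** * Sums of cosines over the Chebyshev nodes *)

Section ChebyshevNodes.
Context {R : realType}.
Implicit Types (x y u : R) (N n m r j k : nat).

Lemma sin_natMpi k : sin (k%:R * pi) = 0 :> R.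
Proof.
elim: k => [|k IH]; first by rewrite mul0r sin0.
by rewrite -natr1 mulrDl mul1r sinDpi IH oppr0.
Qed.

Lemma acos_node n k : (1 <= k <= n)%N ->
  acos (cheb_node R n k) = (2 * k - 1)%N%:R * pi / (2 * n)%N%:R.
Proof.
move=> /andP[k1 kn]; have n0 : (0 : R) < (2 * n)%:R by rewrite ltr0n; lia.
rewrite cosK// in_itv/= divr_ge0 ?mulr_ge0 ?pi_ge0//=.
by rewrite ler_pdivrMr// mulrC ler_wpM2l ?pi_ge0// ler_nat; lia.
Qed.

(** Exactness of Gauss-Chebyshev quadrature below degree 2n, together with the first aliased
    frequency 2n, where every term is cos((2i - 1) pi) = -1. The next exceptional frequency would be
    4n. *)
Lemma sum_cos_node n k : (0 < n)%N -> (k < 4 * n)%N ->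
  \sum_(1 <= i < n.+1) cos (k%:R * acos (cheb_node R n i)) =
  n%:R * ((k == 0)%N%:R - (k == 2 * n)%N%:R).
Proof.
move=> n0 k4n; have n20 : (2 * n)%:R != 0 :> R by rewrite pnatr_eq0; lia.
under eq_big_nat => i Hi do rewrite acos_node//.
have [->|k0] := eqVneq k 0%N.
  under eq_bigr do rewrite mul0r cos0.
  rewrite sumr_const_nat subn1/= (_ : (0 == 2 * n)%N = false) ?subr0 ?mulr1//.
  by apply/negbTE; lia.
have [->|k2n] := eqVneq k (2 * n)%N.
  rewrite big_add1/= (eq_bigr (fun=> - 1)) ?sumr_const_nat ?subn0 ?sub0r ?mulrN1 ?mulNrn//.
  move=> i _; rewrite mulrC divfK// (_ : (2 * i.+1 - 1 = i * 2 + 1)%N); last by lia.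
  rewrite natrD mulrDl mul1r natrM -mulrA [i%:R * _]mulr_natl [2%:R * _]mulr_natl addrC.
  by rewrite (periodicn (@cosD2pi R)) cospi.
rewrite subrr mulr0; set h := k%:R * pi / (2 * n)%:R : R.
(* Since 0 < k < 4n and k is not 2n, [h] lies in (0, 2 pi) and differs from pi. *)
have sh0 : sin h != 0.
  have h0 : 0 < h by rewrite divr_gt0 ?mulr_gt0 ?pi_gt0 ?ltr0n//; lia.
  have hE : h = (k%:R / (2 * n)%:R) * pi by rewrite /h mulrAC.
  case: (ltngtP k (2 * n)%N) k2n => // kn _.
    rewrite gt_eqF// sin_gt0_pi// h0 hE gtr_pMl ?pi_gt0//.
    by rewrite ltr_pdivrMr ?mul1r ?ltr_nat// ltr0n; lia.
  rewrite -[h](subrK pi) sinDpi oppr_eq0 gt_eqF// sin_gt0_pi//.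
  rewrite subr_gt0 ltrBlDr -mulr2n -mulr_natl hE.
  rewrite -[ltLHS]mul1r !ltr_pM2r ?pi_gt0// ltr_pdivlMr ?ltr_pdivrMr ?ltr0n; [|lia..].
  by rewrite mul1r -natrM !ltr_nat; lia.
(* After multiplication by sin h, 2 sin h cos((2i - 1)h) = sin(2ih) - sin(2(i - 1)h) makes the sum
   telescope to sin(2nh) / 2, and 2nh = k pi. *)
apply: (mulfI sh0); rewrite mulr0 mulr_sumr.
transitivity (\sum_(1 <= i < n.+1) (sin ((i * 2)%:R * h) - sin ((i.-1 * 2)%:R * h)) / 2).
  apply: eq_big_nat => i /andP[i1 _].
  have -> : k%:R * ((2 * i - 1)%:R * pi / (2 * n)%:R) = (2 * i - 1)%:R * h.
    by rewrite /h !mulrA [k%:R * _]mulrC.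
  have -> : (i * 2)%:R * h = (2 * i - 1)%:R * h + h.
    by rewrite (_ : i * 2 = (2 * i - 1).+1)%N -?natr1 ?mulrDl ?mul1r//; lia.
  have -> : (i.-1 * 2)%:R * h = (2 * i - 1)%:R * h - h.
    rewrite (_ : 2 * i - 1 = (i.-1 * 2).+1)%N; last by lia.
    by rewrite -natr1 mulrDl mul1r addrK.
  by rewrite sinD sinB; field.
rewrite -mulr_suml big_add1/= telescope_sumr// mul0n mul0r sin0 subr0.
have -> : (n * 2)%:R * h = k%:R * pi by rewrite mulnC /h mulrC divfK.
by rewrite sin_natMpi mul0r.
Qed.

End ChebyshevNodes.

(** * The substitution y = cos t against the singular weight *)

Section ChebyshevWeight.
Context {R : realType}.
Implicit Types (x y u : R) (N n m r j k : nat).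
Local Open Scope classical_set_scope.
Local Notation mu := (@lebesgue_measure R).
Local Notation D := (`](-1)%R, 1%R[ : set R).

Lemma cheb_w_ge0 x : 0 <= cheb_w x.
Proof. by rewrite invr_ge0 sqrtr_ge0. Qed.

Lemma continuous_cheb_w x : -1 < x < 1 -> {for x, continuous (@cheb_w R)}.
Proof.
move=> /andP[x1 x2]; apply: cvgV.
  by rewrite sqrtr_eq0 -ltNge; nra.
apply: (@continuous_comp _ _ _ (fun x => 1 - x ^+ 2) Num.sqrt); last exact: sqrt_continuous.
by apply: cvgB; [exact: cvg_cst|apply: exprn_continuous].
Qed.

Lemma continuous_comp_acos (g : R -> R) x : continuous g -> -1 < x < 1 ->
  {for x, continuous (g \o @acos R)}.
Proof.
by move=> cg x1; apply: continuous_comp; [exact: continuous_acos|exact: cg].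
Qed.

(** The weight blows up at both ends, so the fundamental theorem of calculus is applied on compact
    subintervals and monotone convergence, which uses [0 <= g], reaches the open interval. *)
Lemma integral_acos_cheb_w (g G : R -> R) :
  (forall t : R, is_derive t 1 G (g t)) -> continuous g -> (forall t, 0 <= g t) ->
  (\int[mu]_(y in D) (g (acos y) * cheb_w y)%:E = (G pi - G 0)%:E)%E.
Proof.
move=> dG cg g0.
have cG : continuous G.
  by move=> t; apply/differentiable_continuous/derivable1_diffP; have [] := dG t.
(* The shift by 2 keeps every [eps k] strictly below 1 <= pi / 2, so that its cosine [a k] is
   positive. *)
pose eps k : R := k.+2%:R^-1.
have eps_gt0 k : 0 < eps k by rewrite invr_gt0.
have eps_lim : eps @ \oo --> (0 : R).
  by rewrite (cvg_shiftS (fun k => k.+1%:R^-1 : R)); exact: cvg_harmonic.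
have eps_ltpi2 k : eps k < pi / 2.
  by rewrite (lt_le_trans _ (pihalf_ge1 R))// invf_lt1// ltr1n.
have eps_I k : (eps k \in `[0, pi])%R.
  rewrite in_itv/= (ltW (eps_gt0 k)) (le_trans (ltW (eps_ltpi2 k)))//.
  by rewrite ler_pdivrMr// ler_peMr ?pi_ge0// ler1n.
pose a k := cos (eps k).
have a0 k : 0 < a k.
  by rewrite cos_gt0_pihalf// eps_ltpi2 andbT (lt_trans _ (eps_gt0 k))// oppr_lt0 (lt_trans _ (eps_ltpi2 k)).
have a1 k : a k < 1.
  by rewrite -cos0 ltr_cos ?eps_I// in_itv/= lexx pi_ge0.
have alim : a @ \oo --> (1 : R).
  by rewrite -cos0; apply: continuous_cvg => //; exact: continuous_cos.
have subD k x : - a k <= x <= a k -> -1 < x < 1.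
  move=> /andP[h1 h2].
  by rewrite (lt_le_trans _ h1) ?ltrN2//= (le_lt_trans h2).
have cf x : -1 < x < 1 -> {for x, continuous (fun y => g (acos y) * cheb_w y)}.
  by move=> xD; apply: continuousM; [exact: continuous_comp_acos|exact: continuous_cheb_w].
have FTC k : (\int[mu]_(y in `[(- a k)%R, a k]) (g (acos y) * cheb_w y)%:E =
    (G (pi - eps k) - G (eps k))%:E)%E.
  (* An antiderivative of the integrand, because acos' = - [cheb_w] on the open interval. *)
  pose F y := - G (acos y).
  have dF x : -1 < x < 1 -> is_derive x 1 F (g (acos x) * cheb_w x).
    move=> xD; have dacos := is_derive1_acos xD.
    have := @is_derive1_comp _ G _ _ _ _ (dG (acos x)) dacos.
    move=> /is_deriveN; rewrite /GRing.scale/= mulrN opprK; exact.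
  have cF : {within `[- a k, a k], continuous F}.
    by apply: derivable_within_continuous => x; rewrite in_itv/= => /subD /dF [].
  have aa : - a k < a k by rewrite (lt_trans _ (a0 k))// oppr_lt0.
  rewrite (@continuous_FTC2 _ _ F) //.
  - rewrite /F -EFinB; congr (_%:E); rewrite opprK addrC; congr (G _ - G _).
      by rewrite acosN ?cosK// (ltW (a1 k)) andbT (le_trans _ (ltW (a0 k)))// lerN10.
    by rewrite cosK.
  - apply/continuous_within_itvP => //; split.
    + by move=> x /subset_itv_oo_cc; rewrite in_itv/= => /subD; exact: cf.
    + by apply: cvg_at_right_filter; apply: cf; apply: (subD k); rewrite lexx ltW.
    + by apply: cvg_at_left_filter; apply: cf; apply: (subD k); rewrite lexx ltW.
  - move/(continuous_within_itvP _ aa) : cF => [_ Fl Fr]; split => //.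
    by move=> x /subset_itv_oo_cc; rewrite in_itv/= => /subD/dF [].
  - move=> x /subset_itv_oo_cc; rewrite in_itv/= => /subD/dF Fx.
    by rewrite derive1E; have [_] := Fx.
pose A k : set R := `[- a k, a k].
have bigA : \bigcup_k A k = D.
  apply/seteqP; split => [x [k _ /=]|x /=]; first by rewrite /A/= in_itv/= => /subD; rewrite in_itv.
  rewrite in_itv/= => /andP[x1 x2].
  have /alim : \forall y \near (1 : R), `|x| < y by apply: lt_nbhsr; rewrite ltr_norml x1 x2.
  move=> [k _ /(_ k (leqnn k)) /= xk]; exists k => //=.
  by rewrite /A/= in_itv/= -ler_norml ltW.
have cvg1 : (\int[mu]_(y in A k) (g (acos y) * cheb_w y)%:E @[k --> \oo] -->
    \int[mu]_(y in D) (g (acos y) * cheb_w y)%:E)%E.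
  rewrite -bigA; apply: ge0_nondecreasing_set_cvg_integral.
  - apply/nondecreasing_seqP => k; apply/subsetPset => x; rewrite /A/= !in_itv/=.
    have : a k <= a k.+1.
      by rewrite ltW// ltr_cos ?eps_I// /eps ltf_pV2 ?posrE// ltr_nat.
    by move=> kk /andP[h1 h2]; rewrite (le_trans _ h1) ?lerN2// (le_trans h2).
  - by move=> k; exact: measurable_itv.
  - move=> k; apply/measurable_EFinP; apply: measurable_funS (_ : A k `<=` D) _ => //.
      by move=> x; rewrite /A/= !in_itv/= => /subD.
    by apply: open_continuous_measurable_fun => // x; rewrite inE/= in_itv/=; apply: cf.
  - by move=> k x _; rewrite lee_fin mulr_ge0// cheb_w_ge0.
have cvg2 : (\int[mu]_(y in A k) (g (acos y) * cheb_w y)%:E @[k --> \oo] -->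
    (G pi - G 0)%:E)%E.
  under eq_cvg do rewrite FTC.
  apply: cvg_EFin; first exact: nearW.
  apply: cvgB; last by apply: continuous_cvg => //; exact: cG.
  apply: continuous_cvg; first exact: cG.
  by rewrite -[X in _ --> X]subr0; apply: cvgB => //; exact: cvg_cst.
exact: cvg_unique cvg1 cvg2.
Qed.

End ChebyshevWeight.

(** * Integration against the weight, orthonormality and moments of the Cesaro kernels *)

Section ChebyshevIntegral.
Context {R : realType}.
Implicit Types (x y u : R) (N n m r j k : nat) (f g : R -> R).
Local Open Scope classical_set_scope.
Local Notation mu := (@lebesgue_measure R).
Local Notation D := (`](-1)%R, 1%R[ : set R).

(** A class stable under sums, products and absolute values in which integrability against the
    weight is automatic. The bound can be global since |cos| <= 1 at every value of [acos]. *)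
Definition bounded_mfun f := measurable_fun D f /\ exists M, forall y, `|f y| <= M.

Lemma bounded_mfun_cst (c : R) : bounded_mfun (fun=> c).
Proof. by split; [exact: measurable_cst|exists `|c|]. Qed.

Lemma bounded_mfunD f g : bounded_mfun f -> bounded_mfun g ->
  bounded_mfun (fun y => f y + g y).
Proof.
move=> [mf [M fM]] [mg [M' gM]]; split; first exact: measurable_funD.
by exists (M + M') => y; rewrite (le_trans (ler_normD _ _))// lerD.
Qed.

Lemma bounded_mfunM f g : bounded_mfun f -> bounded_mfun g ->
  bounded_mfun (fun y => f y * g y).
Proof.
move=> [mf [M fM]] [mg [M' gM]]; split; first exact: measurable_funM.
by exists (M * M') => y; rewrite normrM ler_pM.
Qed.

Lemma bounded_mfun_norm f : bounded_mfun f -> bounded_mfun (fun y => `|f y|).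
Proof.
move=> [mf [M fM]]; split; first exact: measurableT_comp.
by exists M => y; rewrite normr_id.
Qed.

Lemma bounded_mfun_sum I (s : seq I) (f : I -> R -> R) : (forall i, bounded_mfun (f i)) ->
  bounded_mfun (fun y => \sum_(i <- s) f i y).
Proof.
move=> bf; elim: s => [|i s IH].
  by under eq_fun do rewrite big_nil; exact: bounded_mfun_cst.
by under eq_fun do rewrite big_cons; exact: bounded_mfunD.
Qed.

Lemma continuous_cosM (c : R) : continuous (fun t : R => cos (c * t)).
Proof.
move=> t; apply: (@continuous_comp _ _ _ ( *%R c) cos); first exact: mulrl_continuous.
exact: continuous_cos.
Qed.

Lemma bounded_mfun_cos k : bounded_mfun (fun y => cos (k%:R * acos y)).
Proof.
split; last by exists 1 => y; exact: cos_max.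
apply: open_continuous_measurable_fun => // y; rewrite inE/= in_itv/= => yD.
apply: (@continuous_comp_acos _ (fun t => cos (k%:R * t))) => // t.
exact: continuous_cosM.
Qed.

Lemma bounded_mfun_cheb_p r : bounded_mfun (@cheb_p R r).
Proof.
rewrite (_ : cheb_p r = fun y => cheb_c r * cos (r%:R * acos y)).
  by apply: bounded_mfunM; [exact: bounded_mfun_cst|exact: bounded_mfun_cos].
by apply/funext => y; exact: cheb_pE.
Qed.

Lemma bounded_mfun_cesaro N z : bounded_mfun (cesaro_kernel N z).
Proof.
apply: bounded_mfun_sum => r; apply: bounded_mfunM; first exact: bounded_mfun_cst.
by apply: bounded_mfunM; [exact: bounded_mfun_cst|exact: bounded_mfun_cheb_p].
Qed.

(** Domination by a multiple of the weight, whose own integral is finite by the substitution with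
    [g = 1]. *)
Lemma integrable_cheb_w f : bounded_mfun f ->
  mu.-integrable D (EFin \o (fun y => f y * cheb_w y)).
Proof.
move=> [mf [M fM]].
have mw : measurable_fun D (@cheb_w R).
  apply: open_continuous_measurable_fun => // y; rewrite inE/= in_itv/=.
  exact: continuous_cheb_w.
have iw : mu.-integrable D (EFin \o @cheb_w R).
  apply/integrableP; split; first exact/measurable_EFinP.
  have -> : (\int[mu]_(y in D) `|(EFin \o @cheb_w R) y| = \int[mu]_(y in D) (1 * cheb_w y)%:E)%E.
    by apply: eq_integral => y _; rewrite /= mul1r ger0_norm ?cheb_w_ge0.
  rewrite (@integral_acos_cheb_w _ (fun=> 1) id) ?ltry// => t.
  exact: cvg_cst.
apply: (@le_integrable _ _ _ mu D _ _ (fun y => (M%:E * (cheb_w y)%:E)%E)) => //.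
- by apply/measurable_EFinP; exact: measurable_funM.
- move=> y _ /=; rewrite lee_fin !normrM ler_wpM2r// (le_trans (fM y))//.
  exact: ler_norm.
- exact: integrableZl.
Qed.

(** Real-valued and over the open interval, away from the singular endpoints; [integral_cheb_w]
    returns to the closed one. *)
Definition cheb_int f : R := (\int[mu]_(y in D) (f y * cheb_w y))%R.

Lemma cheb_intD f g : bounded_mfun f -> bounded_mfun g ->
  cheb_int (fun y => f y + g y) = cheb_int f + cheb_int g.
Proof.
move=> bf bg; rewrite -RintegralD//; [|exact: integrable_cheb_w..].
by apply: eq_Rintegral => y _; rewrite mulrDl.
Qed.

Lemma cheb_intZ (c : R) f : bounded_mfun f -> cheb_int (fun y => c * f y) = c * cheb_int f.
Proof.
move=> bf; rewrite -RintegralZl//; last exact: integrable_cheb_w.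
by apply: eq_Rintegral => y _; rewrite mulrA.
Qed.

Lemma cheb_int_sum I (s : seq I) (f : I -> R -> R) : (forall i, bounded_mfun (f i)) ->
  cheb_int (fun y => \sum_(i <- s) f i y) = \sum_(i <- s) cheb_int (f i).
Proof.
move=> bf; elim: s => [|i s IH].
  rewrite big_nil -[RHS](mul0r (cheb_int (fun=> 0))) -cheb_intZ ?mul0r; last exact: bounded_mfun_cst.
  by congr cheb_int; apply/funext => y; rewrite big_nil.
rewrite big_cons -IH -cheb_intD//; last exact: bounded_mfun_sum.
by congr cheb_int; apply/funext => y; rewrite big_cons.
Qed.

Lemma le_cheb_int f g : bounded_mfun f -> bounded_mfun g -> (forall y, f y <= g y) ->
  cheb_int f <= cheb_int g.
Proof.
move=> bf bg fg; apply: le_Rintegral => //; [exact: integrable_cheb_w..|].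
by move=> y _; rewrite ler_wpM2r ?cheb_w_ge0.
Qed.

Lemma le_norm_cheb_int f : bounded_mfun f -> `|cheb_int f| <= cheb_int (fun y => `|f y|).
Proof.
move=> bf; rewrite (le_trans (le_normr_Rintegral _ _))//; first exact: integrable_cheb_w.
rewrite le_eqVlt; apply/orP; left; apply/eqP; apply: eq_Rintegral => y _.
by rewrite normrM (ger0_norm (cheb_w_ge0 _)).
Qed.

Lemma integral_cheb_w f : bounded_mfun f ->
  (\int[mu]_(y in `[(-1)%R, 1%R]) (f y * cheb_w y)%:E = (cheb_int f)%:E)%E.
Proof.
move=> bf; have iD := integrable_cheb_w _ bf.
rewrite integral_itv_bndoo; last by case/integrableP: iD.
by rewrite fineK//; exact: integrable_fin_num.
Qed.

Lemma cheb_int_cos k : cheb_int (fun y => cos (k%:R * acos y)) = pi * (k == 0)%N%:R.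
Proof.
have I1 : cheb_int (fun=> 1) = pi.
  rewrite /cheb_int /Rintegral (@integral_acos_cheb_w _ (fun=> 1) id) ?subr0// => t.
  exact: cvg_cst.
case: eqVneq => [->|k0].
  by rewrite mulr1 -[RHS]I1; congr cheb_int; apply/funext => y; rewrite mul0r cos0.
have kn0 : k%:R != 0 :> R by rewrite pnatr_eq0.
(* The integrand is shifted by 1 because [integral_acos_cheb_w] needs a nonnegative one. *)
suff : cheb_int (fun y => 1 + cos (k%:R * acos y)) = pi.
  rewrite cheb_intD; [|exact: bounded_mfun_cst|exact: bounded_mfun_cos].
  by rewrite I1 mulr0 => /eqP; rewrite -subr_eq0 addrAC subrr add0r => /eqP.
pose G (t : R) := t + k%:R^-1 * sin (k%:R * t).
have dG (t : R) : is_derive t 1 G (1 + cos (k%:R * t)).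
  have ds : is_derive t 1 (fun t => sin (k%:R * t)) (cos (k%:R * t) * k%:R).
    have dk : is_derive t 1 ( *%R (k%:R : R)) k%:R.
      have := is_deriveZ (k%:R : R) (is_derive_id t (1 : R)).
      by rewrite /GRing.scale/= mulr1.
    exact: (is_derive1_comp (is_derive_sin _) dk).
  have := is_deriveD (is_derive_id t (1 : R)) (is_deriveZ (k%:R^-1) ds).
  by rewrite /GRing.scale/= mulrCA mulVf ?mulr1.
rewrite /cheb_int /Rintegral (integral_acos_cheb_w _ _ dG) /G.
- by rewrite /= sin_natMpi !mulr0 sin0 mulr0 !addr0 subr0.
- by move=> t; apply: continuousD; [exact: cvg_cst|exact: continuous_cosM].
- by move=> t; rewrite -lerBlDl sub0r cos_geN1.
Qed.

Lemma cheb_int_cheb_pM r j : cheb_int (fun y => cheb_p r y * cheb_p j y) = (r == j)%:R.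
Proof.
rewrite -cheb_c_orthonormal -!cheb_int_cos -cheb_intD; [|exact: bounded_mfun_cos..].
rewrite -cheb_intZ; last by apply: bounded_mfunD; exact: bounded_mfun_cos.
by congr cheb_int; apply/funext => y; rewrite cheb_pM.
Qed.

(** Orthonormality keeps only the term j = r of the kernel. For r >= N there is none, and the
    truncated [N - r] is 0 as well. *)
Lemma cheb_int_cheb_p_cesaro r N z :
  cheb_int (fun y => cheb_p r y * cesaro_kernel N z y) = (N - r)%:R * cheb_p r z.
Proof.
transitivity (cheb_int (fun y => \sum_(j < N)
    ((N - j)%:R * cheb_p j z) * (cheb_p r y * cheb_p j y))).
  congr cheb_int; apply/funext => y; rewrite mulr_sumr; apply: eq_bigr => j _.
  by rewrite mulrCA -!mulrA [cheb_p r y * (_ * _)]mulrCA.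
rewrite cheb_int_sum => [|j]; last first.
  apply: bounded_mfunM; first exact: bounded_mfun_cst.
  by apply: bounded_mfunM; exact: bounded_mfun_cheb_p.
transitivity (\sum_(j < N) if r == j :> nat then (N - r)%:R * cheb_p r z else 0).
  apply: eq_bigr => j _; rewrite cheb_intZ ?cheb_int_cheb_pM.
    by case: eqP => [->|_]; rewrite ?mulr1 ?mulr0.
  by apply: bounded_mfunM; exact: bounded_mfun_cheb_p.
have [rN|Nr] := ltnP r N.
  by rewrite -big_mkcond/= (big_pred1 (Ordinal rN)).
by rewrite (eqP Nr) mul0r big1// => j _; case: eqP.
Qed.

(** The previous lemma at r = 0, divided by the nonzero constant p_0. *)
Lemma cheb_int_cesaro N z : cheb_int (cesaro_kernel N z) = N%:R.
Proof.
have p0 y : cheb_p 0 y = cheb_c 0 :> R by rewrite cheb_pE mul0r cos0 mulr1.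
have c0 : cheb_c 0 != 0 :> R by rewrite /cheb_c/= gt_eqF// sqrtr_gt0 invr_gt0 pi_gt0.
apply: (mulfI c0); have := cheb_int_cheb_p_cesaro 0 N z.
rewrite subn0 p0 [RHS]mulrC => <-; rewrite -cheb_intZ; last exact: bounded_mfun_cesaro.
by congr cheb_int; apply/funext => y; rewrite p0.
Qed.

End ChebyshevIntegral.

(** * Discrete orthogonality at the nodes and the VP interpolation formula *)

Section DiscreteOrthogonality.
Context {R : realType}.
Implicit Types (x y u : R) (N n m r j k i : nat).

(** The second delta is aliasing: of the two frequencies |r - j| and r + j, only r + j can equal 2n,
    where the cosine sum is -n. *)
Lemma sum_node_cheb_pM n r j : (r < n)%N -> (j < 2 * n)%N ->
  pi / n%:R * \sum_(1 <= i < n.+1) cheb_p r (cheb_node R n i) * cheb_p j (cheb_node R n i) =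
  (r == j)%:R - (r + j == 2 * n)%N%:R.
Proof.
move=> rn jn; have n0 : (0 < n)%N by lia.
have nR0 : n%:R != 0 :> R by rewrite pnatr_eq0; lia.
under eq_bigr do rewrite cheb_pM.
rewrite -mulr_sumr big_split/= !sum_cos_node//; [|lia..].
rewrite (_ : (r - j + (j - r) == 2 * n)%N = false); last by apply/negbTE; lia.
(* When r + j = 2n the bounds force r and j to be positive, so both constants are sqrt(2 / pi). *)
have rjE : (r + j == 2 * n)%N%:R = cheb_c r * cheb_c j / 2 * (pi * (r + j == 2 * n)%N%:R) :> R.
  case: eqP => rj; last by rewrite !mulr0.
  rewrite (_ : cheb_c r = cheb_c j); last first.
    by rewrite /cheb_c !ifF//; apply/negbTE; lia.
  rewrite -expr2 cheb_c_sqr (_ : (j == 0)%N = false); last by apply/negbTE; lia.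
  have := lt0r_neq0 (@pi_gt0 R); move: (@pi R) => p p0; rewrite subr0 mulr1.
  by rewrite /=; field.
rewrite [in RHS]rjE -(cheb_c_orthonormal r j) /=.
move: (@pi R) => p; rewrite subr0.
by field.
Qed.

Lemma sum_node_cheb_p n j : (0 < n)%N -> (j < 2 * n)%N ->
  \sum_(1 <= i < n.+1) cheb_p j (cheb_node R n i) = n%:R * cheb_c j * (j == 0)%N%:R.
Proof.
move=> n0 jn; under eq_bigr do rewrite cheb_pE.
rewrite -mulr_sumr sum_cos_node//; last by lia.
by rewrite (ltn_eqF jn) subr0 mulrA [_ * n%:R]mulrC.
Qed.

(** All degrees in the kernel are below 2n, so the nodal sum retains only r = 0, as the integral
    does. *)
Lemma sum_node_cesaro n N y : (0 < n)%N -> (N <= 2 * n)%N ->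
  \sum_(1 <= i < n.+1) cesaro_kernel N (cheb_node R n i) y = n%:R * N%:R / pi.
Proof.
move=> n0 Nn; rewrite exchange_big/=; case: N Nn => [|N] Nn.
  by rewrite big_ord0 mulr0 mul0r.
rewrite big_ord_recl/= [X in _ + X]big1 => [|r _].
  rewrite -mulr_sumr -mulr_suml sum_node_cheb_p//; last by lia.
  rewrite cheb_pE mul0r cos0 !mulr1 -mulrA -expr2 cheb_c_sqr/= addr0 subn0.
  by rewrite (_ : 2 - 1 = 1 :> R) ?mul1r; [rewrite mulrCA mulrA|lra].
rewrite -mulr_sumr -mulr_suml sum_node_cheb_p//; first by rewrite !mulr0 mul0r mulr0.
by rewrite /bump/=; have := ltn_ord r; lia.
Qed.

(** At a node, 2n acos x_i = (2i - 1) pi, and cos((2i - 1) pi - t) = -cos t. *)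
Lemma cheb_p_node_reflect n r i : (0 < r < n)%N -> (1 <= i <= n)%N ->
  cheb_p (2 * n - r) (cheb_node R n i) = - cheb_p r (cheb_node R n i).
Proof.
move=> rn iN; have n20 : (2 * n)%:R != 0 :> R by rewrite pnatr_eq0; lia.
rewrite !cheb_pE (_ : cheb_c (2 * n - r) = cheb_c r); last first.
  by rewrite /cheb_c !ifF//; apply/negbTE; lia.
rewrite -mulrN natrB; last by lia.
rewrite mulrBl acos_node// [X in cos (X - _)]mulrC divfK//.
set t := r%:R * _; rewrite cosB sin_natMpi mul0r addr0.
have -> : cos ((2 * i - 1)%:R * pi) = -1 :> R.
  rewrite (_ : 2 * i - 1 = i.-1 * 2 + 1)%N; last by lia.
  rewrite natrD mulrDl mul1r natrM -mulrA [_.-1%:R * _]mulr_natl [2%:R * _]mulr_natl addrC.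
  by rewrite (periodicn (@cosD2pi R)) cospi.
by rewrite mulN1r.
Qed.

Lemma cesaro_kernel_wide N n x y : (N <= n)%N ->
  cesaro_kernel N x y = \sum_(r < n) (N - r)%:R * (cheb_p r x * cheb_p r y).
Proof.
move=> Nn; rewrite /cesaro_kernel.
rewrite -(big_mkord xpredT (fun r => (N - r)%:R * (cheb_p r x * cheb_p r y))).
rewrite -(big_mkord xpredT (fun r => (N - r)%:R * (cheb_p r x * cheb_p r y))).
rewrite [RHS](big_cat_nat (n := N))//= [X in _ = _ + X](_ : _ = 0) ?addr0//.
rewrite big_nat_cond big1// => r /andP[/andP[Nr _] _].
by rewrite (eqP Nr) mul0r.
Qed.

(** The trapezoidal filter is a difference of two triangular ones, so the difference of the Cesaro
    kernels of orders n + m and n - m is 2m times the de la Vallee Poussin kernel. *)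
Lemma vp_mu_cesaro n m j : (0 < m < n)%N ->
  (n + m - j)%:R - (n - m - j)%:R = (2 * m)%:R * vp_mu R n m j.
Proof.
move=> mn; have m0 : (2 * m)%:R != 0 :> R by rewrite pnatr_eq0; lia.
rewrite /vp_mu; case: ifPn => [j1|j1].
  by rewrite mulr1 -natrB; [congr (_%:R)|]; lia.
rewrite (_ : n - m - j = 0)%N ?subr0; last by lia.
case: ifPn => [j2|j2]; last by rewrite mulr0 (_ : n + m - j = 0)%N//; lia.
by rewrite mulrC divfK// natrB ?[(m + n)%N]addnC//; lia.
Qed.

(** Reflection turns the correction term into a multiple of p_r, and mu_r + mu_(2n-r) = 1. *)
Lemma vp_q_node n m r i : (0 < m < n)%N -> (r < n)%N -> (1 <= i <= n)%N ->
  vp_q n m r (cheb_node R n i) = cheb_p r (cheb_node R n i).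
Proof.
move=> mn rn iN; rewrite /vp_q; case: ifPn => // rm.
rewrite cheb_p_node_reflect//; last by lia.
have m0 : (2 * m)%:R != 0 :> R by rewrite pnatr_eq0; lia.
rewrite mulrN opprK -mulrDl -[RHS]mul1r; congr (_ * _).
apply: (mulfI m0); rewrite mulrDr -!vp_mu_cesaro// mulr1.
rewrite (_ : n - m - r = 0)%N ?subr0; last by lia.
rewrite (_ : n - m - (2 * n - r) = 0)%N ?subr0; last by lia.
by rewrite -natrD; congr (_%:R); lia.
Qed.

(** At the nodes q_r is p_r. Discrete orthogonality against the filtered kernel then selects mu_r
    p_r at j = r and, by aliasing, - mu_(2n-r) p_(2n-r) at j = 2n - r, which together are q_r
    again. *)
Lemma vp_q_reproducing n m r y : (0 < m < n)%N -> (r < n)%N ->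
  (2 * m)%:R * vp_q n m r y = pi / n%:R * \sum_(1 <= i < n.+1)
     vp_q n m r (cheb_node R n i) *
     (cesaro_kernel (n + m) (cheb_node R n i) y - cesaro_kernel (n - m) (cheb_node R n i) y).
Proof.
move=> mn rn.
transitivity (\sum_(j < 2 * n) (2 * m)%:R * vp_mu R n m j * cheb_p j y *
    ((r == j)%:R - (r + j == 2 * n)%N%:R)); last first.
  under eq_bigr => j _ do rewrite -(sum_node_cheb_pM _ _ _ rn (ltn_ord j)) mulrCA mulr_sumr.
  rewrite -mulr_sumr exchange_big/=; congr (_ * _).
  apply: eq_big_nat => i iN; rewrite vp_q_node//.
  rewrite !(cesaro_kernel_wide _ (2 * n)); [|lia..].
  rewrite -sumrB mulr_sumr; apply: eq_bigr => j _.
  rewrite -mulrBl vp_mu_cesaro//; ring.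
transitivity ((2 * m)%:R * vp_mu R n m r * cheb_p r y -
    (2 * m)%:R * vp_mu R n m (2 * n - r) * cheb_p (2 * n - r) y).
  (* For r <= n - m the two-term formula still holds, since mu_r = 1 and 2n - r >= n + m gives
     mu_(2n-r) = 0. *)
  rewrite /vp_q; case: ifPn => rm; last by rewrite mulrBr !mulrA.
  rewrite [in X in _ - X]/vp_mu ifF ?ifF; [|lia..].
  by rewrite /vp_mu rm mulr1 mulr0 mul0r subr0.
under eq_bigr do rewrite mulrBr.
rewrite sumrB; congr (_ - _).
  have r2n : (r < 2 * n)%N by lia.
  rewrite (bigD1 (Ordinal r2n))//= eqxx mulr1 big1 ?addr0// => j jr.
  by rewrite (_ : (r == j) = false) ?mulr0//; apply/negbTE; rewrite eq_sym.
(* For r = 0 the reflected index 2n falls outside the sum, consistently with mu_(2n) = 0. *)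
have [r0|r0] := posnP r.
  rewrite r0 big1 => [|j _].
    rewrite /vp_mu ifF ?ifF ?mulr0 ?mul0r//; lia.
  by rewrite add0n ltn_eqF ?mulr0.
have r2n : (2 * n - r < 2 * n)%N by lia.
rewrite (bigD1 (Ordinal r2n))//= subnKC ?eqxx ?mulr1 ?big1 ?addr0//; last by lia.
move=> j jr; rewrite (_ : (r + j == 2 * n)%N = false) ?mulr0//.
by apply/negbTE; move: jr; apply: contraNneq => jr; apply/eqP/val_inj => /=; lia.
Qed.

End DiscreteOrthogonality.

(** * Comparison of weighted integrals and nodal sums of |F| for reproduced F *)

Section LebesgueFunctions.
Context {R : realType}.
Implicit Types (x y z : R) (F : R -> R) (N n m r j k a b : nat).

Definition integral_repr a b F := bounded_mfun F /\ forall z, (a - b)%:R * F z =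
  cheb_int (fun y => F y * (cesaro_kernel a z y - cesaro_kernel b z y)).

Definition nodal_repr n a b F := forall y, (a - b)%:R * F y =
  pi / n%:R * \sum_(1 <= i < n.+1) F (cheb_node R n i) *
    (cesaro_kernel a (cheb_node R n i) y - cesaro_kernel b (cheb_node R n i) y).

Lemma bounded_mfun_cesaroB a b z :
  bounded_mfun (fun y : R => cesaro_kernel a z y - cesaro_kernel b z y).
Proof.
rewrite (_ : (fun y => _) = (fun y => cesaro_kernel a z y + -1 * cesaro_kernel b z y)).
  apply: bounded_mfunD; first exact: bounded_mfun_cesaro.
  by apply: bounded_mfunM; [exact: bounded_mfun_cst|exact: bounded_mfun_cesaro].
by apply/funext => y; rewrite mulN1r.
Qed.

Lemma bounded_mfun_cesaroD a b z :
  bounded_mfun (fun y : R => cesaro_kernel a z y + cesaro_kernel b z y).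
Proof. by apply: bounded_mfunD; exact: bounded_mfun_cesaro. Qed.

Lemma le_norm_cesaroB a b x y : `|cesaro_kernel a x y - cesaro_kernel b x y| <=
  cesaro_kernel a x y + cesaro_kernel b x y.
Proof. by rewrite (le_trans (ler_normB _ _))// !ger0_norm ?cesaro_kernel_ge0. Qed.

(** Reproduction is linear in F, which reduces the case of [vp_s] to the [vp_q], and these to the
    [cheb_p]. *)
Lemma integral_repr_lincomb a b I (s : seq I) (c : I -> R) (f : I -> R -> R) :
  (forall i, integral_repr a b (f i)) ->
  integral_repr a b (fun y => \sum_(i <- s) c i * f i y).
Proof.
move=> rf; have bcf i : bounded_mfun (fun y => c i * f i y).
  by apply: bounded_mfunM; [exact: bounded_mfun_cst|exact: (rf i).1].
split=> [|z]; first exact: bounded_mfun_sum.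
rewrite mulr_sumr.
transitivity (\sum_(i <- s) cheb_int (fun y => c i * f i y *
    (cesaro_kernel a z y - cesaro_kernel b z y))).
  apply: eq_bigr => i _; rewrite mulrCA (rf i).2 -cheb_intZ.
    by congr cheb_int; apply/funext => y; rewrite mulrA.
  by apply: bounded_mfunM; [exact: (rf i).1|exact: bounded_mfun_cesaroB].
rewrite -cheb_int_sum => [|i]; last by apply: bounded_mfunM; last exact: bounded_mfun_cesaroB.
by congr cheb_int; apply/funext => y; rewrite mulr_suml.
Qed.

Lemma nodal_repr_lincomb n a b I (s : seq I) (c : I -> R) (f : I -> R -> R) :
  (forall i, nodal_repr n a b (f i)) ->
  nodal_repr n a b (fun y => \sum_(i <- s) c i * f i y).
Proof.
move=> rf y; under [in RHS]eq_bigr do rewrite mulr_suml.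
rewrite exchange_big/= !mulr_sumr; apply: eq_bigr => i _.
rewrite mulrCA rf mulrCA; congr (_ * _); rewrite mulr_sumr.
by apply: eq_bigr => k _; rewrite mulrA.
Qed.

(** Up to degree b the multipliers of the two kernels differ by (a - r) - (b - r) = a - b,
    independently of r. *)
Lemma integral_repr_cheb_p a b r : (r <= b <= a)%N -> integral_repr a b (cheb_p r).
Proof.
move=> rba; split=> [|z]; first exact: bounded_mfun_cheb_p.
have bp N : bounded_mfun (fun y => cheb_p r y * cesaro_kernel N z y).
  by apply: bounded_mfunM; [exact: bounded_mfun_cheb_p|exact: bounded_mfun_cesaro].
transitivity (cheb_int (fun y => cheb_p r y * cesaro_kernel a z y +
    -1 * (cheb_p r y * cesaro_kernel b z y))).
  rewrite cheb_intD//; last by apply: bounded_mfunM; first exact: bounded_mfun_cst.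
  rewrite cheb_intZ// !cheb_int_cheb_p_cesaro mulN1r -mulrBl -natrB; last by lia.
  by congr (_%:R * _); lia.
by congr cheb_int; apply/funext => y; rewrite mulrBr mulN1r.
Qed.

Lemma integral_repr_vp_q a n m r : (0 < m < n)%N -> (r < n)%N -> (n + m <= a)%N ->
  integral_repr a (n + m) (vp_q n m r).
Proof.
move=> mn rn na; have [rm|rm] := leqP r (n - m).
  rewrite (_ : vp_q n m r = cheb_p r); first by apply: integral_repr_cheb_p; lia.
  by apply/funext => y; rewrite /vp_q rm.
(* [minn] makes the degree bound hold for every t, not only for those in the list. *)
rewrite (_ : vp_q n m r = fun y => \sum_(t <- [:: (vp_mu R n m r, r);
    (- vp_mu R n m (2 * n - r), (2 * n - r)%N)] | true) t.1 * cheb_p (minn t.2 (n + m)) y).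
  apply: integral_repr_lincomb => t; apply: integral_repr_cheb_p; lia.
apply/funext => y; rewrite !big_cons big_nil addr0/= /vp_q leqNgt rm/= mulNr.
by congr (_ * cheb_p _ _ - _ * cheb_p _ _); lia.
Qed.

(** The grouping exposes two nested linear combinations in [y], to which the linearity lemmas apply
    in turn. *)
Lemma vp_sE n m x y : vp_s n m x y = \sum_(1 <= k < n.+1) vp_phi n m k x *
  (\sum_(r < n) (Num.sqrt (pi / (n%:R * vp_nu R n m r)) * cheb_p r (cheb_node R n k)) *
    vp_q n m r y).
Proof. by []. Qed.

Lemma integral_repr_vp_s a n m x : (0 < m < n)%N -> (n + m <= a)%N ->
  integral_repr a (n + m) (vp_s n m x).
Proof.
move=> mn na; rewrite (funext (vp_sE n m x)).
apply: integral_repr_lincomb => k; apply: integral_repr_lincomb => r.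
exact: integral_repr_vp_q.
Qed.

Lemma nodal_repr_vp_s n m x : (0 < m < n)%N ->
  nodal_repr n (n + m) (n - m) (vp_s n m x).
Proof.
move=> mn; rewrite (funext (vp_sE n m x)).
apply: nodal_repr_lincomb => k; apply: nodal_repr_lincomb => r y.
rewrite -vp_q_reproducing//; congr (_%:R * _); lia.
Qed.

(** One half of an L1 Marcinkiewicz-Zygmund inequality; [a <= 2 * n] makes the nodal sums of both
    kernels exact. *)
Lemma integral_repr_sampling n a b F : (0 < n)%N -> (b <= a <= 2 * n)%N ->
  integral_repr a b F ->
  (a - b)%:R * (pi / n%:R * \sum_(1 <= i < n.+1) `|F (cheb_node R n i)|) <=
  (a + b)%:R * cheb_int (fun y => `|F y|).
Proof.
move=> n0 /andP[ba an] [bF Frep].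
have bN := bounded_mfun_norm _ bF.
have nR0 : n%:R != 0 :> R by rewrite pnatr_eq0; lia.
have pi0 : pi != 0 :> R by rewrite gt_eqF// pi_gt0.
have bS z : bounded_mfun (fun y => `|F y| * (cesaro_kernel a z y + cesaro_kernel b z y)).
  by apply: bounded_mfunM; last exact: bounded_mfun_cesaroD.
have step z : (a - b)%:R * `|F z| <=
    cheb_int (fun y => `|F y| * (cesaro_kernel a z y + cesaro_kernel b z y)).
  rewrite -[(a - b)%:R]ger0_norm// -normrM Frep.
  have bD : bounded_mfun (fun y => F y * (cesaro_kernel a z y - cesaro_kernel b z y)).
    by apply: bounded_mfunM; last exact: bounded_mfun_cesaroB.
  rewrite (le_trans (le_norm_cheb_int _ bD))// le_cheb_int//; first exact: bounded_mfun_norm.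
  by move=> y; rewrite normrM ler_wpM2l// le_norm_cesaroB.
rewrite mulrCA mulr_sumr.
rewrite (le_trans (ler_wpM2l _ (ler_sum _ (fun i _ => step (cheb_node R n i)))))//.
  by rewrite divr_ge0// pi_ge0.
rewrite -cheb_int_sum//.
(* Summed over the nodes, the kernels give n (a + b) / pi for every [y], a constant that leaves the
   integral. *)
under [in X in cheb_int X]eq_fun => y.
  rewrite -mulr_sumr big_split/= !sum_node_cesaro//; last by lia.
  rewrite -mulrDl -mulrDr -natrD mulrC; over.
rewrite cheb_intZ// le_eqVlt; apply/orP; left; apply/eqP.
by move: (@pi R) pi0 => p p0; field; apply/andP.
Qed.

(** The opposite half: |F| is dominated by a nodal combination of nonnegative kernels, whose
    integrals do not depend on the node. *)
Lemma nodal_repr_reconstruction n a b F : bounded_mfun F -> nodal_repr n a b F ->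
  (a - b)%:R * cheb_int (fun y => `|F y|) <=
  (a + b)%:R * (pi / n%:R * \sum_(1 <= i < n.+1) `|F (cheb_node R n i)|).
Proof.
move=> bF Frep; have bN := bounded_mfun_norm _ bF.
have pin0 : 0 <= pi / n%:R :> R by rewrite divr_ge0// pi_ge0.
pose t i := pi / n%:R * `|F (cheb_node R n i)|.
pose S i y := cesaro_kernel a (cheb_node R n i) y + cesaro_kernel b (cheb_node R n i) y.
have bS i : bounded_mfun (fun y => t i * S i y).
  by apply: bounded_mfunM; [exact: bounded_mfun_cst|exact: bounded_mfun_cesaroD].
rewrite -cheb_intZ//.
apply: (@le_trans _ _ (cheb_int (fun y => \sum_(1 <= i < n.+1) t i * S i y))).
  apply: le_cheb_int; [by apply: bounded_mfunM; first exact: bounded_mfun_cst| |move=> y].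
    exact: bounded_mfun_sum.
  rewrite -[(a - b)%:R]ger0_norm// -normrM Frep normrM ger0_norm//.
  under [leRHS]eq_bigr do rewrite -mulrA.
  rewrite -mulr_sumr ler_wpM2l// (le_trans (ler_norm_sum _ _ _))// ler_sum// => i _.
  by rewrite normrM ler_wpM2l// le_norm_cesaroB.
rewrite cheb_int_sum// !mulr_sumr ler_sum// => i _.
rewrite cheb_intZ; last exact: bounded_mfun_cesaroD.
by rewrite cheb_intD ?cheb_int_cesaro -?natrD 1?mulrC//; exact: bounded_mfun_cesaro.
Qed.

Lemma vp_sC n m x y : vp_s n m x y = vp_s n m y x.
Proof. by apply: eq_bigr => k _; rewrite mulrC. Qed.

End LebesgueFunctions.

(** * Equivalence of the two Lebesgue functions *)

Theorem theorem2 (R : realType) (theta : R) (htheta : 0 < theta < 1) :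
  exists C1 C2 : R, 0 < C1 /\ 0 < C2 /\
    forall (n : nat), let m := Num.truncn (theta * n%:R) in
      (1 <= m)%N ->
      forall x : R, -1 <= x <= 1 ->
        (C1%:E * vp_lambda n m x <= (vp_lambda_tilde n m x)%:E)%E /\
        ((vp_lambda_tilde n m x)%:E <= C2%:E * vp_lambda n m x)%E.
Proof.
(* The two comparisons give the ratios m / n and (3n + m) / (n - m). From theta n < m + 1 <= 2m the
   first is at least theta / 2; from m <= theta n and m <= n the second is at most 4 / (1 -
   theta). *)
case/andP: htheta => t0 t1; exists (theta / 2), (4 / (1 - theta)).
have t1' : 0 < 1 - theta by rewrite subr_gt0.
split; first by rewrite divr_gt0.
split; first by rewrite divr_gt0.
move=> n m m1 x _; have tn0 : 0 <= theta * n%:R by rewrite mulr_ge0// ltW.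
have /andP[mle mgt] := truncn_itv tn0; rewrite -/m in mle mgt.
have mR1 : 1 <= m%:R :> R by rewrite ler1n.
have n0 : (0 < n)%N.
  by case: (posnP n) mle => // ->; rewrite mulr0 => h; have := le_trans mR1 h; rewrite ler10.
have nR0 : 0 < n%:R :> R by rewrite ltr0n.
have mn : (m < n)%N.
  by rewrite -(ltr_nat R) (le_lt_trans mle)// gtr_pMl.
have mn' : (0 < m < n)%N by rewrite m1.
have rA : integral_repr (2 * n) (n + m) (vp_s n m x) by apply: integral_repr_vp_s => //; lia.
have rB := nodal_repr_vp_s _ _ x mn'.
have bN := bounded_mfun_norm _ rA.1.
rewrite /vp_lambda (integral_cheb_w _ bN).
(* [vp_lambda_tilde] puts [x] second and [vp_lambda] puts it first; symmetry of the kernel aligns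
   them. *)
have -> : vp_lambda_tilde n m x =
    pi / n%:R * \sum_(1 <= i < n.+1) `|vp_s n m x (cheb_node R n i)|.
  by congr (_ * _); apply: eq_bigr => i _; rewrite vp_sC.
have := nodal_repr_reconstruction _ _ _ _ rA.1 rB.
have := integral_repr_sampling _ _ _ _ n0 _ rA.
have I0 : 0 <= cheb_int (fun y => `|vp_s n m x y|).
  by apply: Rintegral_ge0 => y _; rewrite mulr_ge0 ?cheb_w_ge0.
set T := pi / n%:R * _; set I := cheb_int _ in I0 *.
rewrite (_ : 2 * n - (n + m) = n - m)%N; last by lia.
rewrite (_ : n + m - (n - m) = 2 * m)%N; last by lia.
rewrite (_ : n + m + (n - m) = 2 * n)%N; last by lia.
move=> /(_ ltac:(lia)) hA hB.
rewrite -!EFinM !lee_fin; split.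
  rewrite -(ler_pM2l (_ : 0 < (2 * n)%:R :> R)); last by rewrite ltr0n; lia.
  apply: le_trans hB; rewrite mulrA ler_wpM2r// !natrM.
  by move: mgt; rewrite -natr1; nra.
have nm0 : 0 < (n - m)%:R :> R by rewrite ltr0n; lia.
rewrite -(ler_pM2l nm0); apply: (le_trans hA); rewrite mulrA ler_wpM2r//.
rewrite mulrA ler_pdivlMr//.
rewrite natrD natrD natrM natrB ?(ltnW mn)//.
have mnR : m%:R <= n%:R :> R by rewrite ler_nat ltnW.
have : 0 <= (n%:R - m%:R) * (1 - theta) by rewrite mulr_ge0 ?subr_ge0// ltW.
by lra.
Qed.
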